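(* The string $0212$ has sorting distance $3$. Every other normalized fully ternary string $s$ of length $n$ ending in the symbol $2$ has $d_{\rm s}(s)=n-2$ if $s$ is bad and $d_{\rm s}(s)=n-3$ if $s$ is good. A normalized fully ternary string $s$ ending in $0$ or $1$ has the same sorting distance as the string $s2$ ($s$ followed by the symbol $2$).
   Context: Strings are finite words over $\{0,1,2,\dots\}$. A string is \emph{normalized} if no two adjacent symbols are equal; the \emph{normalization} of a string replaces every maximal run of identical symbols by a single copy. A string is \emph{fully $k$-ary} if the set of symbols occurring in it is exactly $\{0,\dots,k-1\}$; fully ternary means fully $3$-ary. For a normalized string $s=s_1\cdots s_n$ and $1\le i\le n$, the flip $f^{(i)}(s)$ is the normalization of $s_i\cdots s_1 s_{i+1}\cdots s_n$. The sorting distance $d_{\rm s}(s)$ of a normalized fully ternary string is the minimum number of flips needed to transform $s$ into $012$. Regular-expression notation: $w^i$ is $i$ repetitions of $w$, $w^*$ is zero or more, $w^+$ one or more, $w^{\ge 2}$ two or more repetitions; $\{a,b\}$ denotes a single symbol that is either $a$ or $b$ (chosen independently at each occurrence). A normalized fully ternary string ending in $2$ is \emph{bad} (for sorting; no relabelling allowed) if it is of one of the following types: (I) $0(12)^{\ge 2}$; (II) $(\{0,1\}2)^+$ or $2(\{0,1\}2)^+$; (III) $(\{1,2\}0)^+2$ or $0(\{1,2\}0)^+2$; (IV) $(\{1,2\}0)^+12$ or $(0\{1,2\})^+012$, in either case containing at least two occurrences of $2$; (V) $(01)^*0212$ or $(10)^+212$; (VI) $1(20)^+1(20)^*2$ or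 $0(21)^+0(21)^*2$; (VII) $1(02)^+1(02)^+$; (VIII) $1(02)^+12$; (IX) one of the following 77 strings: 210212, 021012, 212012, 120102, 201202, 0210202, 1021202, 0212012, 2120102, 0102102, 1212012, 2010212, 0120212, 1201012, 1201212, 2012012, 10210212, 21021212, 02102012, 02101212, 10212012, 02121012, 02120102, 10102102, 02010212, 21202012, 21201012, 21201202, 20210212, 01021202, 01020212, 20212012, 12120102, 12010212, 12010202, 20120102, 12012012, 021021202, 102120102, 102010212, 021202012, 021201012, 020210212, 101020212, 020212012, 212010202, 212012012, 010210212, 010210202, 010212012, 202010212, 121202012, 121201202, 201021202, 120212012, 012021212, 120102012, 201202012, 120120212, 201201012, 0210212012, 1021202012, 1021201012, 1020210212, 1010210202, 0202010212, 2120202012, 2120102012, 2021021212, 2010212012, 1201021202, 1201202012, 10202010212, 02120102012, 02021021212, 21201202012, 12120202012. All other normalized fully ternary strings ending in $2$ are \emph{good}. (In particular $0212$ is bad, of type V.) *)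

(* Defs.v *)
From mathcomp Require Import all_boot.
Set Implicit Arguments.
Unset Strict Implicit.
Unset Printing Implicit Defensive.

Definition normalized (s : seq nat) : bool := sorted (fun a b => a != b) s.

Fixpoint normalize (s : seq nat) : seq nat :=
  match s with
  | x :: ((y :: _) as s') => if x == y then normalize s' else x :: normalize s'
  | _ => s
  end.

Definition fully_kary (k : nat) (s : seq nat) : Prop :=
  forall x : nat, x \in s <-> x < k.

Definition fully_ternary (s : seq nat) : Prop := fully_kary 3 s.

Definition flip (i : nat) (s : seq nat) : seq nat :=
  normalize (rev (take i s) ++ drop i s).

Fixpoint reach (k : nat) (s t : seq nat) : Prop :=
  match k with
  | 0 => s = t
  | k'.+1 => exists i, 0 < i <= size s /\ reach k' (flip i s) t
  end.

Definition target : seq nat := [:: 0; 1; 2].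

Definition sorting_distance_is (s : seq nat) (d : nat) : Prop :=
  reach d s target /\ (forall m, m < d -> ~ reach m s target).

Definition pairs_of (f : nat -> seq nat) (xs : seq nat) : seq nat := flatten (map f xs).
Definition in01 (x : nat) : bool := (x == 0) || (x == 1).
Definition in12 (x : nat) : bool := (x == 1) || (x == 2).
Definition rep (k : nat) (w : seq nat) : seq nat := flatten (nseq k w).

Definition bad_I (s : seq nat) : Prop :=
  exists k, 2 <= k /\ s = 0 :: rep k [:: 1; 2].

Definition bad_II (s : seq nat) : Prop :=
  exists xs, xs != [::] /\ all in01 xs /\
    (s = pairs_of (fun x => [:: x; 2]) xs \/ s = 2 :: pairs_of (fun x => [:: x; 2]) xs).

Definition bad_III (s : seq nat) : Prop :=
  exists xs, xs != [::] /\ all in12 xs /\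
    (s = pairs_of (fun x => [:: x; 0]) xs ++ [:: 2] \/
     s = 0 :: pairs_of (fun x => [:: x; 0]) xs ++ [:: 2]).

Definition bad_IV (s : seq nat) : Prop :=
  2 <= count_mem 2 s /\
  exists xs, xs != [::] /\ all in12 xs /\
    (s = pairs_of (fun x => [:: x; 0]) xs ++ [:: 1; 2] \/
     s = pairs_of (fun x => [:: 0; x]) xs ++ [:: 0; 1; 2]).

Definition bad_V (s : seq nat) : Prop :=
  (exists k, s = rep k [:: 0; 1] ++ [:: 0; 2; 1; 2]) \/
  (exists k, 1 <= k /\ s = rep k [:: 1; 0] ++ [:: 2; 1; 2]).

Definition bad_VI (s : seq nat) : Prop :=
  (exists k l, 1 <= k /\ s = 1 :: rep k [:: 2; 0] ++ 1 :: rep l [:: 2; 0] ++ [:: 2]) \/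
  (exists k l, 1 <= k /\ s = 0 :: rep k [:: 2; 1] ++ 0 :: rep l [:: 2; 1] ++ [:: 2]).

Definition bad_VII (s : seq nat) : Prop :=
  exists k l, 1 <= k /\ 1 <= l /\ s = 1 :: rep k [:: 0; 2] ++ 1 :: rep l [:: 0; 2].

Definition bad_VIII (s : seq nat) : Prop :=
  exists k, 1 <= k /\ s = 1 :: rep k [:: 0; 2] ++ [:: 1; 2].

Definition bad_IX_list : seq (seq nat) := [::
  [:: 2; 1; 0; 2; 1; 2];
  [:: 0; 2; 1; 0; 1; 2];
  [:: 2; 1; 2; 0; 1; 2];
  [:: 1; 2; 0; 1; 0; 2];
  [:: 2; 0; 1; 2; 0; 2];
  [:: 0; 2; 1; 0; 2; 0; 2];
  [:: 1; 0; 2; 1; 2; 0; 2];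
  [:: 0; 2; 1; 2; 0; 1; 2];
  [:: 2; 1; 2; 0; 1; 0; 2];
  [:: 0; 1; 0; 2; 1; 0; 2];
  [:: 1; 2; 1; 2; 0; 1; 2];
  [:: 2; 0; 1; 0; 2; 1; 2];
  [:: 0; 1; 2; 0; 2; 1; 2];
  [:: 1; 2; 0; 1; 0; 1; 2];
  [:: 1; 2; 0; 1; 2; 1; 2];
  [:: 2; 0; 1; 2; 0; 1; 2];
  [:: 1; 0; 2; 1; 0; 2; 1; 2];
  [:: 2; 1; 0; 2; 1; 2; 1; 2];
  [:: 0; 2; 1; 0; 2; 0; 1; 2];
  [:: 0; 2; 1; 0; 1; 2; 1; 2];
  [:: 1; 0; 2; 1; 2; 0; 1; 2];
  [:: 0; 2; 1; 2; 1; 0; 1; 2];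
  [:: 0; 2; 1; 2; 0; 1; 0; 2];
  [:: 1; 0; 1; 0; 2; 1; 0; 2];
  [:: 0; 2; 0; 1; 0; 2; 1; 2];
  [:: 2; 1; 2; 0; 2; 0; 1; 2];
  [:: 2; 1; 2; 0; 1; 0; 1; 2];
  [:: 2; 1; 2; 0; 1; 2; 0; 2];
  [:: 2; 0; 2; 1; 0; 2; 1; 2];
  [:: 0; 1; 0; 2; 1; 2; 0; 2];
  [:: 0; 1; 0; 2; 0; 2; 1; 2];
  [:: 2; 0; 2; 1; 2; 0; 1; 2];
  [:: 1; 2; 1; 2; 0; 1; 0; 2];
  [:: 1; 2; 0; 1; 0; 2; 1; 2];
  [:: 1; 2; 0; 1; 0; 2; 0; 2];
  [:: 2; 0; 1; 2; 0; 1; 0; 2];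
  [:: 1; 2; 0; 1; 2; 0; 1; 2];
  [:: 0; 2; 1; 0; 2; 1; 2; 0; 2];
  [:: 1; 0; 2; 1; 2; 0; 1; 0; 2];
  [:: 1; 0; 2; 0; 1; 0; 2; 1; 2];
  [:: 0; 2; 1; 2; 0; 2; 0; 1; 2];
  [:: 0; 2; 1; 2; 0; 1; 0; 1; 2];
  [:: 0; 2; 0; 2; 1; 0; 2; 1; 2];
  [:: 1; 0; 1; 0; 2; 0; 2; 1; 2];
  [:: 0; 2; 0; 2; 1; 2; 0; 1; 2];
  [:: 2; 1; 2; 0; 1; 0; 2; 0; 2];
  [:: 2; 1; 2; 0; 1; 2; 0; 1; 2];
  [:: 0; 1; 0; 2; 1; 0; 2; 1; 2];
  [:: 0; 1; 0; 2; 1; 0; 2; 0; 2];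
  [:: 0; 1; 0; 2; 1; 2; 0; 1; 2];
  [:: 2; 0; 2; 0; 1; 0; 2; 1; 2];
  [:: 1; 2; 1; 2; 0; 2; 0; 1; 2];
  [:: 1; 2; 1; 2; 0; 1; 2; 0; 2];
  [:: 2; 0; 1; 0; 2; 1; 2; 0; 2];
  [:: 1; 2; 0; 2; 1; 2; 0; 1; 2];
  [:: 0; 1; 2; 0; 2; 1; 2; 1; 2];
  [:: 1; 2; 0; 1; 0; 2; 0; 1; 2];
  [:: 2; 0; 1; 2; 0; 2; 0; 1; 2];
  [:: 1; 2; 0; 1; 2; 0; 2; 1; 2];
  [:: 2; 0; 1; 2; 0; 1; 0; 1; 2];
  [:: 0; 2; 1; 0; 2; 1; 2; 0; 1; 2];
  [:: 1; 0; 2; 1; 2; 0; 2; 0; 1; 2];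
  [:: 1; 0; 2; 1; 2; 0; 1; 0; 1; 2];
  [:: 1; 0; 2; 0; 2; 1; 0; 2; 1; 2];
  [:: 1; 0; 1; 0; 2; 1; 0; 2; 0; 2];
  [:: 0; 2; 0; 2; 0; 1; 0; 2; 1; 2];
  [:: 2; 1; 2; 0; 2; 0; 2; 0; 1; 2];
  [:: 2; 1; 2; 0; 1; 0; 2; 0; 1; 2];
  [:: 2; 0; 2; 1; 0; 2; 1; 2; 1; 2];
  [:: 2; 0; 1; 0; 2; 1; 2; 0; 1; 2];
  [:: 1; 2; 0; 1; 0; 2; 1; 2; 0; 2];
  [:: 1; 2; 0; 1; 2; 0; 2; 0; 1; 2];
  [:: 1; 0; 2; 0; 2; 0; 1; 0; 2; 1; 2];
  [:: 0; 2; 1; 2; 0; 1; 0; 2; 0; 1; 2];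
  [:: 0; 2; 0; 2; 1; 0; 2; 1; 2; 1; 2];
  [:: 2; 1; 2; 0; 1; 2; 0; 2; 0; 1; 2];
  [:: 1; 2; 1; 2; 0; 2; 0; 2; 0; 1; 2]].

Definition bad_IX (s : seq nat) : Prop := s \in bad_IX_list.

Definition bad (s : seq nat) : Prop :=
  normalized s /\ fully_ternary s /\ last 0 s = 2 /\
  (bad_I s \/ bad_II s \/ bad_III s \/ bad_IV s \/ bad_V s \/
   bad_VI s \/ bad_VII s \/ bad_VIII s \/ bad_IX s).

Lemma bad_IX_list_size : size bad_IX_list = 77.
Proof. by []. Qed.

(* Main.v *)
Require Import Defs.
From mathcomp Require Import all_boot.

Set Implicit Arguments.
Unset Strict Implicit.
Unset Printing Implicit Defensive.

(** A flip removes at most one symbol, and it removes one exactly when it has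
    the form [a x a y -> rev x a y]; so sorting a string of length [n] takes
    at least [n - 3] flips, and exactly [n - 3] iff every flip can be of this
    form.  The theorem thus reduces to three facts about strings ending in [2]:
    a good string other than [012] has a shrinking flip to a good string; every
    shrinking flip of a bad string is bad; a bad string other than [0212] has
    either a shrinking flip or a length-preserving one to a good string.  All
    these flips may be taken to fix the last symbol.

    The bad strings form a regular language, so these facts are decidable:
    reading [a x a y] from right to left, one remembers for each split point
    the residual language of what may stand in front of [a y]; the result
    [rev x a y] of the flip is then tested by feeding it the remaining symbols
    in the order in which they are read.  Only finitely many collections of
    residual languages arise, and they are enumerated by computation. *)

(** * Regular expressions: derivatives and reversal *)

(* [(true, w)] stands for the star of the word of symbol classes [w],
   [(false, w)] for [w] itself. *)
Definition item := (bool * seq (seq nat))%type.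
Definition regex := seq item.

Definition wmatch (w : seq (seq nat)) (u : seq nat) : bool :=
  all2 (fun C x => x \in C) w u.

Fixpoint lang (e : regex) (s : seq nat) : Prop :=
  if e is (b, w) :: r then
    exists us s', [/\ s = flatten us ++ s', all (wmatch w) us,
                      b || (size us == 1) & lang r s']
  else s = [::].

Definition inL (P : seq regex) (s : seq nat) : Prop := exists2 e, e \in P & lang e s.

(** An exhausted literal is dropped, so that residuals differing only by an empty literal become the
    same term. *)
Definition cons_item (i : item) (r : regex) : regex :=
  if i == (false, [::]) then r else i :: r.

(** Antimirov's partial derivatives: one expression for each way of consuming [a]. Inside a star,
    the rest of the current copy becomes a literal in front of the whole star. *)
Fixpoint pderiv (a : nat) (e : regex) : seq regex :=
  match e with
  | [::] => [::]
  | (b, [::]) :: r => pderiv a r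
  | (b, C :: w) :: r =>
      (if a \in C then [:: cons_item (false, w) (if b then e else r)] else [::])
      ++ (if b then pderiv a r else [::])
  end.

Definition deriv (a : nat) (P : seq regex) : seq regex :=
  undup (flatten (map (pderiv a) P)).

Definition nullable (e : regex) : bool := all (fun i : item => i.1 || nilp i.2) e.
Definition accept (P : seq regex) : bool := has nullable P.

Definition rev_regex (e : regex) : regex := rev [seq (i.1, rev i.2) | i <- e].
Definition rev_lang (P : seq regex) : seq regex := map rev_regex P.

Lemma lang_lit w u r s : wmatch w u -> lang r s -> lang ((false, w) :: r) (u ++ s).
Proof. by move=> h1 h2; exists [:: u], s; rewrite /= cats0 h1. Qed.

Lemma lang_star w us r s :
  all (wmatch w) us -> lang r s -> lang ((true, w) :: r) (flatten us ++ s).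
Proof. by move=> h1 h2; exists us, s. Qed.

Lemma lang_litE w r s :
  lang ((false, w) :: r) s -> exists u s', [/\ s = u ++ s', wmatch w u & lang r s'].
Proof.
case=> us [s' [-> hus hb hr]]; case: us hus hb => [|u [|? ?]] //=.
by rewrite andbT cats0 => hu _; exists u, s'.
Qed.

Lemma lang_nilw b r s : lang ((b, [::]) :: r) s <-> lang r s.
Proof.
split=> [[us [s' [-> h _ hr]]]|h]; last by exists [:: [::]], s; rewrite orbT.
suff -> : flatten us = [::] by [].
by elim: us h => //= -[|? ?] us IH //= /IH.
Qed.

Lemma lang_cons_item i r s : lang (cons_item i r) s <-> lang (i :: r) s.
Proof.
rewrite /cons_item; case: eqP => [->|//].
by apply: iff_sym; apply: lang_nilw.
Qed.

(** Either the leading item contributes nothing, which only a star may do, or its first copy, being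
    nonempty, starts with [a]. *)
Lemma lang_pderiv a e s : lang e (a :: s) <-> inL (pderiv a e) s.
Proof.
elim: e s => [|[b [|C w]] r IH] s.
- by split=> [//|[]].
- by split=> [/lang_nilw/IH|/IH h] //; apply/lang_nilw.
split.
- case=> us [s' [E hus hb hr]].
  case: us E hus hb => [|u us] /= E.
    case: b => // _ _; rewrite -E in hr; have /IH[e ein he] := hr.
    by exists e; rewrite // mem_cat ein orbT.
  case: u E => [|x u] //= [<- ->] /andP[/andP[aC hu] hus] hb.
  exists (cons_item (false, w) (if b then (b, C :: w) :: r else r)).
    by rewrite aC mem_cat mem_head.
  apply/lang_cons_item; rewrite -catA; apply: lang_lit => //.
  by case: b hb => /= hb; [exists us, s' | case: us hus hb].
- case=> e; rewrite mem_cat => /orP[].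
    case: ifP => // aC; rewrite inE => /eqP -> /lang_cons_item /lang_litE[u [s' [-> hu hs]]].
    case: b hs => hs.
      case: hs => us [s'' [-> hus _ hr]].
      by exists ((a :: u) :: us), s''; rewrite /= aC hu hus /= catA.
    by exists [:: a :: u], s'; rewrite /= cats0 aC hu.
  case: b => // ein he; have /IH h : inL (pderiv a r) s by exists e.
  by exists [::], (a :: s).
Qed.

Lemma inL_deriv a P s : inL (deriv a P) s <-> inL P (a :: s).
Proof.
split=> [[e]|[e eP /lang_pderiv[e' e'in he]]].
  rewrite mem_undup => /flatten_mapP[e' e'P e'in] he.
  by exists e' => //; apply/lang_pderiv; exists e.
by exists e' => //; rewrite mem_undup; apply/flatten_mapP; exists e.
Qed.

Lemma lang_nil e : lang e [::] <-> nullable e.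
Proof.
elim: e => [|[b w] r IH] //=; split.
  case=> us [s' [E hus hb hr]].
  have [E1 E2] : flatten us = [::] /\ s' = [::] by case: (flatten us) s' {hr} E => [|? ?] [|? ?].
  rewrite {}E2 in hr E *; apply/andP; split; last exact/IH.
  by case: b hb => //; case: us hus E1 {E} => [|[|? ?] [|? ?]] //=; case: w.
case/andP => hb /IH hr.
case: b w hb => [w _|[|? ?] // _]; first by exists [::], [::].
by exists [:: [::]], [::].
Qed.

Lemma inL_nil P : inL P [::] <-> accept P.
Proof.
split=> [[e eP /lang_nil h]|/hasP[e eP /lang_nil h]]; last by exists e.
by apply/hasP; exists e.
Qed.

Lemma lang_cat e1 e2 s :
  lang (e1 ++ e2) s <-> exists s1 s2, [/\ s = s1 ++ s2, lang e1 s1 & lang e2 s2].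
Proof.
elim: e1 s => [|[b w] r IH] s /=.
  by split=> [h|[s1 [s2 [-> -> //]]]]; exists [::], s.
split.
  case=> us [s' [-> hus hb /IH[s1 [s2 [-> h1 h2]]]]].
  by exists (flatten us ++ s1), s2; rewrite catA; split=> //; exists us, s1.
case=> s1 [s2 [-> [us [s' [-> hus hb hr]]] h2]].
exists us, (s' ++ s2); rewrite catA; split=> //; apply/IH.
by exists s', s2.
Qed.

Lemma wmatch_rev w u : wmatch (rev w) (rev u) = wmatch w u.
Proof.
rewrite /wmatch !all2E !size_rev; case: eqP => //= E.
by rewrite -rev_zip // all_rev.
Qed.

Lemma lang_rev_imp e s : lang e s -> lang (rev_regex e) (rev s).
Proof.
elim: e s => [|[b w] r IH] s; first by move=> /= ->.
case=> us [s' [-> hus hb /IH hr]].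
rewrite /rev_regex /= rev_cons -cats1 rev_cat; apply/lang_cat.
exists (rev s'), (rev (flatten us)); split=> //.
exists (rev (map rev us)), [::]; rewrite cats0 size_rev size_map rev_flatten; split=> //.
by rewrite all_rev all_map; apply: sub_all hus => u /=; rewrite wmatch_rev.
Qed.

Lemma rev_regexK : involutive rev_regex.
Proof.
move=> e; rewrite /rev_regex map_rev revK -map_comp -[RHS]map_id.
by apply: eq_map => -[b w] /=; rewrite revK.
Qed.

Lemma inL_rev P s : inL (rev_lang P) s <-> inL P (rev s).
Proof.
split=> [[e' /mapP[e eP ->] h]|[e eP h]].
  by exists e => //; rewrite -[e]rev_regexK; apply: lang_rev_imp.
by exists (rev_regex e); [apply: map_f | rewrite -[s]revK; apply: lang_rev_imp].
Qed.

(** * The bad strings as a regular language *)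

Definition lit (w : seq nat) : item := (false, [seq [:: x] | x <- w]).
Definition star (w : seq nat) : item := (true, [seq [:: x] | x <- w]).

(** Types I to VIII in order, with two expressions for a type that has two forms. In type IV the
    ending [12] supplies one [2]; the other is made explicit as the literal [20] or [02] between two
    stars. That [xs] is nonempty in types II and III is left to full ternarity. *)
Definition families : seq regex :=
  [:: [:: lit [:: 0; 1; 2; 1; 2]; star [:: 1; 2]];
      [:: (true, [:: [:: 0; 1]; [:: 2]])];
      [:: lit [:: 2]; (true, [:: [:: 0; 1]; [:: 2]])];
      [:: (true, [:: [:: 1; 2]; [:: 0]]); lit [:: 2]];
      [:: lit [:: 0]; (true, [:: [:: 1; 2]; [:: 0]]); lit [:: 2]];
      [:: (true, [:: [:: 1; 2]; [:: 0]]); lit [:: 2; 0];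
          (true, [:: [:: 1; 2]; [:: 0]]); lit [:: 1; 2]];
      [:: (true, [:: [:: 0]; [:: 1; 2]]); lit [:: 0; 2];
          (true, [:: [:: 0]; [:: 1; 2]]); lit [:: 0; 1; 2]];
      [:: star [:: 0; 1]; lit [:: 0; 2; 1; 2]];
      [:: lit [:: 1; 0]; star [:: 1; 0]; lit [:: 2; 1; 2]];
      [:: lit [:: 1; 2; 0]; star [:: 2; 0]; lit [:: 1]; star [:: 2; 0]; lit [:: 2]];
      [:: lit [:: 0; 2; 1]; star [:: 2; 1]; lit [:: 0]; star [:: 2; 1]; lit [:: 2]];
      [:: lit [:: 1; 0; 2]; star [:: 0; 2]; lit [:: 1; 0; 2]; star [:: 0; 2]];
      [:: lit [:: 1; 0; 2]; star [:: 0; 2]; lit [:: 1; 2]]]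
  ++ [seq [:: lit w] | w <- bad_IX_list].

(* The strings with at most two symbols are stable under flips; counting those
   over {0,2} or {1,2} as bad removes full ternarity from the languages. *)
Definition no1 : regex := [:: (true, [:: [:: 0; 2]])].
Definition no0 : regex := [:: (true, [:: [:: 1; 2]])].
Definition bad_lang : seq regex := no1 :: no0 :: families.

(** * An automaton reading strings from right to left *)

(* For a suffix [s] already read: its first 5 symbols, the language of the
   reversed prefixes that complete it to a bad string, and, for each split
   [s = c :: x ++ a :: y], the pair of [a] and the set of [z] such that
   [rev x ++ z ++ a :: y] is bad. *)
Definition state := (seq nat * seq regex * seq (nat * seq regex))%type.

(** When [c] is put in front, the former first symbol [head 0 w] joins [x] in every old split, hence
    comes right after [rev x]: this is a derivative. The one new split has [x] empty, and its
    language is [cur] with the prefixes read forwards. *)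
Definition step (c : nat) (st : state) : state :=
  let: (w, cur, Q) := st in
  (take 5 (c :: w), deriv c cur,
   undup ((head 0 w, rev_lang cur) :: [seq (p.1, deriv (head 0 w) p.2) | p <- Q])).

Definition init : state := ([:: 2], deriv 2 (rev_lang bad_lang), [::]).

(* Both conditions persist under [step]: no extension is bad, and every
   extension has a shrinking flip to a good string. *)
Definition done (st : state) : bool :=
  nilp st.1.2 && all (fun a => (a, [::]) \in st.2) [:: 0; 1; 2].

(** The three checks are the three facts, in order. With [c] the first symbol, [z = [::]] yields the
    result of a shrinking flip, where [a = c], and [z = [:: c]] that of a length-preserving one,
    whence the derivative in [okC]. *)
Definition okA (st : state) : bool :=
  let: (w, cur, Q) := st in
  [|| w == [:: 0; 1; 2], accept cur |
      has (fun p => (p.1 == head 0 w) && ~~ accept p.2) Q].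
Definition okB (st : state) : bool :=
  let: (w, cur, Q) := st in
  accept cur ==> all (fun p => (p.1 == head 0 w) ==> accept p.2) Q.
Definition okC (st : state) : bool :=
  let: (w, cur, Q) := st in
  accept cur ==>
  [|| size w <= 2, w == [:: 0; 2; 1; 2] |
      has (fun p => (p.1 == head 0 w) || ~~ accept (deriv (head 0 w) p.2)) Q].
Definition ok st := [&& okA st, okB st & okC st].

Definition succs (st : state) : seq state :=
  if done st then [::] else [seq step c st | c <- [:: 0; 1; 2] & c != head 0 st.1.1].

Fixpoint explore (k : nat) (seen frontier : seq state) : seq state :=
  if k is k'.+1 then
    let new := undup [seq st <- flatten (map succs frontier) | st \notin seen] in
    explore k' (new ++ seen) new
  else seen.

Definition closed_ok (V : seq state) : bool :=
  (init \in V) && all (fun st => ok st && all (fun st' => st' \in V) (succs st)) V.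

Lemma closed_states : exists V, closed_ok V.
(* Nothing is proved about the search: thirteen breadth-first rounds give a list that passes
   [closed_ok], and only this check is used later. *)
Proof. by exists (explore 13 [:: init] [:: init]); vm_compute. Qed.

Definition state_of (s : seq nat) : state := foldr step init s.

Definition residual (P : seq regex) (x y : seq nat) : Prop :=
  forall z, inL P z <-> inL bad_lang (rev x ++ z ++ y).

Lemma residual_deriv P a x y : residual P x y -> residual (deriv a P) (a :: x) y.
Proof.
move=> h z; apply: iff_trans (inL_deriv _ _ _) _.
by rewrite rev_cons cat_rcons -cat_cons; apply: h.
Qed.

(** The recorded splits are sound, which turns a [has] in the checks into an actual flip, and
    complete, which turns the [all] of [okB] into a claim on every shrinking flip. *)
Lemma state_ofP s0 (s := rcons s0 2) (st := state_of s0) :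
  [/\ st.1.1 = take 5 s,
      forall z, inL st.1.2 z <-> inL bad_lang (rev z ++ s),
      forall a P, (a, P) \in st.2 ->
        exists c x y, s = c :: x ++ a :: y /\ residual P x (a :: y)
    & forall c x a y, s = c :: x ++ a :: y ->
        exists2 P, (a, P) \in st.2 & residual P x (a :: y)].
Proof.
rewrite {}/s {}/st; elim: s0 => [|c s0 [IHw IHcur IHsound IHcompl]].
  split=> [//|z|//|c [|? ?] //].
  apply: iff_trans (inL_deriv 2 (rev_lang bad_lang) z) _; apply: iff_trans (inL_rev _ _) _.
  by rewrite rev_cons -cats1.
have step_eq : state_of (c :: s0) = step c (state_of s0) by [].
rewrite {}step_eq; case E: (state_of s0) => [[w cur] Q].
rewrite {}E in IHw IHcur IHsound IHcompl *.
rewrite /= in IHw IHcur IHsound IHcompl; rewrite rcons_cons /step.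
have [l [t Es]] : exists l t, rcons s0 2 = l :: t.
  by case: (s0) => [|l t]; [exists 2, [::] | exists l, (rcons t 2)].
have -> : head 0 w = l by rewrite IHw Es.
rewrite Es in IHw IHcur IHsound IHcompl *.
have residual_cur : residual (rev_lang cur) [::] (l :: t).
  move=> z; apply: iff_trans (inL_rev _ _) _; apply: iff_trans (IHcur _) _.
  by rewrite revK.
split.
- by rewrite IHw /= take_takel.
- move=> z; apply: iff_trans (inL_deriv _ _ _) _; apply: iff_trans (IHcur _) _.
  by rewrite rev_cons cat_rcons.
- move=> a P; rewrite mem_undup inE => /orP[/eqP[-> ->]|/mapP[[a' P'] /IHsound]].
    by exists c, [::], t.
  move=> [l' [x [y [[El ->] hP]]]] [-> ->]; exists c, (l :: x), y; split=> //.
  exact: residual_deriv.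
- move=> c' [|l' x] a y [_].
    move=> <- <-; exists (rev_lang cur) => //; by rewrite mem_undup mem_head.
  move=> <- Et; have [|P hP hres] := IHcompl l x a y; first by rewrite Et.
  exists (deriv l P); last exact: residual_deriv.
  rewrite mem_undup inE; apply/orP; right.
  by apply/mapP; exists (a, P).
Qed.

Lemma done_step c st : done st -> done (step c st).
Proof.
case: st => [[w cur] Q] /andP[/nilP E h]; rewrite /= in E; subst cur.
apply/andP; split=> //; apply: sub_all h => a ha.
rewrite mem_undup inE; apply/orP; right.
by apply/mapP; exists (a, [::]).
Qed.

(** [done] is absorbing, and [V] is closed under the letters that keep the string normalized, so
    reading never leaves their union. *)
Lemma closed_reach V s :
  closed_ok V -> normalized (rcons s 2) -> all (fun a => a < 3) s ->
  done (state_of s) || (state_of s \in V).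
Proof.
case/andP=> V0 /allP hV; elim: s => [|c s IH]; first by rewrite V0 orbT.
rewrite /normalized rcons_cons /= => hn /andP[c3 s3].
have /IH/(_ s3) : normalized (rcons s 2) by apply: path_sorted hn.
case: (boolP (done _)) => [d _|nd /= /hV/andP[_ /allP hsucc]].
  by rewrite (done_step c d).
apply/orP; right; apply: hsucc; rewrite /succs (negbTE nd); apply: map_f.
have [-> _ _ _] := state_ofP s.
rewrite mem_filter !inE; apply/andP; split; last by case: c c3 {hn} => [|[|[]]].
by move: hn; case: (s) => [|d t] /= /andP[].
Qed.

Lemma done_ok s : all (fun a => a < 3) s -> done (state_of s) -> ok (state_of s).
Proof.
move=> s3; have [] := state_ofP s; case: (state_of s) => [[w cur] Q] /= Ew _ _ _.
case/andP=> /nilP E /allP h; rewrite /= in E; subst cur.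
rewrite /ok /okA /= !andbT; apply/orP; right.
apply/hasP; exists (head 0 w, [::]); last by rewrite /= eqxx.
apply: h; rewrite Ew; case: s s3 {Ew} => [//|c s] /= /andP[c3 _].
by case: c c3 => [|[|[]]].
Qed.

Lemma state_ok s :
  normalized (rcons s 2) -> all (fun a => a < 3) s -> ok (state_of s).
Proof.
move=> hn s3; have [V hV] := closed_states; have := closed_reach hV hn s3.
case/orP; first exact: done_ok.
by case/andP: hV => _ /allP h /h /andP[].
Qed.

(** * The three facts for fully ternary strings ending in 2 *)

Definition admissible (s : seq nat) : Prop :=
  [/\ normalized s, fully_ternary s & last 0 s = 2].

Lemma admissible_state s : admissible s ->
  exists s0, [/\ s = rcons s0 2, ok (state_of s0) &
    accept (state_of s0).1.2 <-> inL bad_lang s].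
Proof.
case=> hn ht; case/lastP: s hn ht => [//|s0 b] hn ht; rewrite last_rcons => Eb.
rewrite {}Eb in hn ht *; exists s0; split=> //.
  apply: state_ok => //; apply/allP=> a ha; apply/ht.
  by rewrite mem_rcons inE ha orbT.
have [_ h _ _] := state_ofP s0.
by apply: iff_trans (iff_sym (inL_nil _)) _; apply: iff_trans (h _) _.
Qed.

Lemma good_shrinks s : admissible s -> ~ inL bad_lang s -> s <> target ->
  exists a x y, s = a :: x ++ a :: y /\ ~ inL bad_lang (rev x ++ a :: y).
Proof.
move=> /admissible_state[s0 [Es hok hcur]] hgood htarget; move: hok hcur.
have [] := state_ofP s0; rewrite -Es; case: (state_of s0) => [[w cur] Q] /= Ew _ hQ _.
case/and3P => hA _ _ hcur; case/or3P: hA => [/eqP Ew'|/hcur //|].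
  by case: htarget; move: Ew' Ew => ->; case: (s) => [|? [|? [|? [|? ?]]]].
case/hasP=> -[a P] /hQ[c [x [y [E hres]]]] /andP[/=/eqP Ea hP].
move: Ea; rewrite Ew E /= => Ea; subst c; exists a, x, y; split=> // hb.
by move/negP: hP; apply; apply/inL_nil/hres.
Qed.

Lemma bad_shrinks a x y : admissible (a :: x ++ a :: y) ->
  inL bad_lang (a :: x ++ a :: y) -> inL bad_lang (rev x ++ a :: y).
Proof.
set s := a :: _ => /admissible_state[s0 [Es hok hcur]] hbad; move: hok hcur.
have [] := state_ofP s0; rewrite -Es; case: (state_of s0) => [[w cur] Q] /= Ew _ _ hQ.
case/and3P => _ hB _ [_ /(_ hbad) hcur].
have [P /(allP (implyP hB hcur)) /=] := hQ a x a y erefl.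
by rewrite Ew eqxx /= => /inL_nil hP /(_ [::])[/(_ hP)].
Qed.

Lemma bad_exit s : admissible s -> inL bad_lang s -> s <> [:: 0; 2; 1; 2] ->
  (exists a x y, s = a :: x ++ a :: y) \/
  (exists c x a y, [/\ s = c :: x ++ a :: y, c != a &
                      ~ inL bad_lang (rev x ++ c :: a :: y)]).
Proof.
move=> hs hbad hneq; have [_ ht _] := hs; case/admissible_state: hs => s0 [Es hok hcur].
move: hok hcur.
have [] := state_ofP s0; rewrite -Es; case: (state_of s0) => [[w cur] Q] /= Ew _ hQ _.
case/and3P => _ _ hC [_ /(_ hbad) hcur].
case/or3P: (implyP hC hcur) => [hw|/eqP Ew'|].
(* If [take 5 s] has length at most two, so has [s], which leaves no room for three symbols. *)
- move: hw (ht 0) (ht 1) (ht 2); rewrite Ew.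
  case: (s) => [|a [|b [|? [|? ?]]]] //= _; first by case=> _ /(_ isT).
  + by case=> _ /(_ isT); rewrite inE => /eqP <- [_ /(_ isT)].
  + case=> _ /(_ isT) h0 [_ /(_ isT) h1] [_ /(_ isT)]; move: h0 h1; rewrite !inE.
    by case/orP=> /eqP ?; case/orP=> /eqP ?; case/orP=> /eqP ?; congruence.
(* Five symbols are remembered so that a window equal to [0212] is the whole string. *)
- by case: hneq; move: Ew' Ew => ->; case: (s) => [|? [|? [|? [|? [|? [|? ?]]]]]].
case/hasP=> -[a P] /hQ[c [x [y [E hres]]]] /=; rewrite Ew E /=.
have [->|neq] /= := eqVneq a c; first by left; exists c, x, y.
move=> hP; right; exists c, x, a, y; split=> //; first by rewrite eq_sym.
by move=> hb; move/negP: hP; apply; apply/inL_nil/inL_deriv/hres.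
Qed.

(** * Agreement of the language with the types of bad strings *)

Lemma wmatch_word w u : wmatch [seq [:: x] | x <- w] u = (u == w).
Proof. by elim: w u => [|x w IH] [|y u] //=; rewrite inE IH eqseq_cons. Qed.

Lemma lang_word w r s :
  lang (lit w :: r) s <-> exists2 s', s = w ++ s' & lang r s'.
Proof.
split=> [/lang_litE[u [s' [-> /[!wmatch_word] /eqP-> hr]]]|[s' -> hr]]; first by exists s'.
by apply: lang_lit => //; rewrite wmatch_word.
Qed.

Lemma lang_power w r s :
  lang (star w :: r) s <-> exists k, exists2 s', s = rep k w ++ s' & lang r s'.
Proof.
split=> [[us [s' [-> hus _ hr]]]|[k [s' -> hr]]].
  exists (size us), s' => //; congr (_ ++ _).
  by elim: us hus => //= u us IH; rewrite wmatch_word => /andP[/eqP-> /IH ->].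
by apply: lang_star => //; apply/allP=> u /nseqP[-> _]; rewrite wmatch_word.
Qed.

Definition pairl (b x : nat) := [:: x; b].
Definition pairr (b x : nat) := [:: b; x].

Lemma lang_pairl A b r s :
  lang ((true, [:: A; [:: b]]) :: r) s <->
  exists2 xs, all (mem A) xs & exists2 s', s = pairs_of (pairl b) xs ++ s' & lang r s'.
Proof.
split=> [[us [s' [-> hus _ hr]]]|[xs hxs [s' -> hr]]].
  exists (map (head 0) us); last exists s' => //; last congr (_ ++ _).
    rewrite all_map; apply: sub_all hus => -[|x u] //=; by case: andP => // -[].
  elim: us hus => //= -[|x [|y [|? ?]]] us IH //=; rewrite ?andbF // => /andP[/and3P[_]].
  by rewrite inE => /eqP -> _ /IH ->.
apply: lang_star => //; rewrite all_map; apply: sub_all hxs => x /= ->.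
by rewrite inE eqxx.
Qed.

Lemma lang_pairr A b r s :
  lang ((true, [:: [:: b]; A]) :: r) s <->
  exists2 xs, all (mem A) xs & exists2 s', s = pairs_of (pairr b) xs ++ s' & lang r s'.
Proof.
split=> [[us [s' [-> hus _ hr]]]|[xs hxs [s' -> hr]]].
  exists (map (last 0) us); last exists s' => //; last congr (_ ++ _).
    rewrite all_map; apply: sub_all hus => -[|x [|y [|? ?]]] //=; rewrite ?andbF //.
    by case/and3P.
  elim: us hus => //= -[|x [|y [|? ?]]] us IH //=; rewrite ?andbF // => /andP[/and3P[]].
  by rewrite inE => /eqP -> _ _ /IH ->.
apply: lang_star => //; rewrite all_map; apply: sub_all hxs => x /= ->.
by rewrite inE eqxx.
Qed.

Lemma lang_letters A s : lang [:: (true, [:: A])] s -> all (mem A) s.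
Proof.
case=> us [s' [-> hus _ ->]]; rewrite cats0; elim: us hus => //= -[|x [|? ?]] us IH //=.
  by rewrite andbT => /andP[-> /IH ->].
by rewrite andbF.
Qed.

Lemma all_in01 xs : all (mem [:: 0; 1]) xs = all in01 xs.
Proof. by apply: eq_all => x; rewrite /in01 /= !inE. Qed.

Lemma all_in12 xs : all (mem [:: 1; 2]) xs = all in12 xs.
Proof. by apply: eq_all => x; rewrite /in12 /= !inE. Qed.

Lemma pairs_of_cat f xs ys : pairs_of f (xs ++ ys) = pairs_of f xs ++ pairs_of f ys.
Proof. by rewrite /pairs_of map_cat flatten_cat. Qed.

Lemma count_pairl xs : count_mem 2 (pairs_of (pairl 0) xs) = count_mem 2 xs.
Proof. by elim: xs => //= x xs ->. Qed.

Lemma count_pairr xs : count_mem 2 (pairs_of (pairr 0) xs) = count_mem 2 xs.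
Proof. by elim: xs => //= x xs ->. Qed.

(** Positions 0 and 1 hold [no1] and [no0], positions 2 to 14 the families of types I to VIII; the
    words of type IX follow. *)
Lemma bad_lang_cat :
  bad_lang = take 15 bad_lang ++ [seq [:: lit w] | w <- bad_IX_list].
Proof. by []. Qed.

Lemma bad_lang_family i s :
  i < size bad_lang -> lang (nth [::] bad_lang i) s -> inL bad_lang s.
Proof. by move=> hi h; exists (nth [::] bad_lang i); first exact: mem_nth. Qed.

Lemma lang_word1 w : lang [:: lit w] w.
Proof. by apply/lang_word; exists [::]; rewrite ?cats0. Qed.

Lemma bad_inL s : bad s -> inL bad_lang s.
Proof.
case=> _ [_ [_]]; case=> [|[|[|[|[|[|[|[|]]]]]]]].
- case=> -[|[|k]] [] // _ ->; apply: (@bad_lang_family 2) => //.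
  apply/lang_word; exists (rep k [:: 1; 2]) => //.
  by apply/lang_power; exists k, [::]; rewrite ?cats0.
- case=> xs [_ [hxs hs]]; rewrite -all_in01 in hxs.
  have h : lang [:: (true, [:: [:: 0; 1]; [:: 2]])] (pairs_of (pairl 2) xs).
    by apply/lang_pairl; exists xs => //; exists [::]; rewrite ?cats0.
  case: hs => ->; first by apply: (@bad_lang_family 3).
  apply: (@bad_lang_family 4) => //; apply/lang_word.
  by exists (pairs_of (pairl 2) xs).
- case=> xs [_ [hxs hs]]; rewrite -all_in12 in hxs.
  have h : lang [:: (true, [:: [:: 1; 2]; [:: 0]]); lit [:: 2]] (pairs_of (pairl 0) xs ++ [:: 2]).
    by apply/lang_pairl; exists xs => //; exists [:: 2] => //; apply: lang_word1.
  case: hs => ->; first by apply: (@bad_lang_family 5).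
  apply: (@bad_lang_family 6) => //; apply/lang_word.
  by exists (pairs_of (pairl 0) xs ++ [:: 2]).
- case=> h2 [xs [_ [hxs hs]]]; rewrite -all_in12 in hxs.
  have x2 : 2 \in xs.
    rewrite -has_pred1 has_count; move: h2.
    by case: hs => ->; rewrite count_cat ?count_pairl ?count_pairr; case: (count _ xs).
  case/splitPr: x2 hxs hs => p q; rewrite all_cat => /and3P[hp _ hq] hs.
  case: hs => ->; rewrite pairs_of_cat -catA.
  + apply: (@bad_lang_family 7) => //; apply/lang_pairl; exists p => //.
    exists (pairs_of (pairl 0) (2 :: q) ++ [:: 1; 2]) => //.
    apply/lang_word; exists (pairs_of (pairl 0) q ++ [:: 1; 2]) => //.
    apply/lang_pairl; exists q => //; exists [:: 1; 2] => //; exact: lang_word1.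
  + apply: (@bad_lang_family 8) => //; apply/lang_pairr; exists p => //.
    exists (pairs_of (pairr 0) (2 :: q) ++ [:: 0; 1; 2]) => //.
    apply/lang_word; exists (pairs_of (pairr 0) q ++ [:: 0; 1; 2]) => //.
    apply/lang_pairr; exists q => //; exists [:: 0; 1; 2] => //; exact: lang_word1.
- case=> [[k ->]|[[|k] [] // _ ->]].
  + apply: (@bad_lang_family 9) => //; apply/lang_power.
    by exists k, [:: 0; 2; 1; 2] => //; apply: lang_word1.
  + apply: (@bad_lang_family 10) => //; apply/lang_word.
    exists (rep k [:: 1; 0] ++ [:: 2; 1; 2]) => //; apply/lang_power.
    by exists k, [:: 2; 1; 2] => //; apply: lang_word1.
- case=> -[[|k] [l [] // _ ->]].
  + apply: (@bad_lang_family 11) => //; apply/lang_word.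
    exists (rep k [:: 2; 0] ++ 1 :: rep l [:: 2; 0] ++ [:: 2]) => //; apply/lang_power.
    exists k, (1 :: rep l [:: 2; 0] ++ [:: 2]) => //; apply/lang_word.
    exists (rep l [:: 2; 0] ++ [:: 2]) => //; apply/lang_power.
    by exists l, [:: 2] => //; apply: lang_word1.
  + apply: (@bad_lang_family 12) => //; apply/lang_word.
    exists (rep k [:: 2; 1] ++ 0 :: rep l [:: 2; 1] ++ [:: 2]) => //; apply/lang_power.
    exists k, (0 :: rep l [:: 2; 1] ++ [:: 2]) => //; apply/lang_word.
    exists (rep l [:: 2; 1] ++ [:: 2]) => //; apply/lang_power.
    by exists l, [:: 2] => //; apply: lang_word1.
- case=> -[|k] [[|l] [] // _ [] // _ ->].
  apply: (@bad_lang_family 13) => //; apply/lang_word.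
  exists (rep k [:: 0; 2] ++ 1 :: rep l.+1 [:: 0; 2]) => //; apply/lang_power.
  exists k, (1 :: rep l.+1 [:: 0; 2]) => //; apply/lang_word.
  exists (rep l [:: 0; 2]) => //; apply/lang_power.
  by exists l, [::]; rewrite ?cats0.
- case=> -[|k] [] // _ ->.
  apply: (@bad_lang_family 14) => //; apply/lang_word.
  exists (rep k [:: 0; 2] ++ [:: 1; 2]) => //; apply/lang_power.
  by exists k, [:: 1; 2] => //; apply: lang_word1.
- move=> hs; exists [:: lit s]; last exact: lang_word1.
  rewrite bad_lang_cat mem_cat; apply/orP; right.
  exact: (map_f (fun w => [:: lit w]) hs).
Qed.

Lemma in_bad_lang (P : regex -> Prop) :
  (forall i, i < 15 -> P (nth [::] bad_lang i)) ->
  (forall w, w \in bad_IX_list -> P [:: lit w]) ->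
  forall e, e \in bad_lang -> P e.
Proof.
move=> hfam hix e; rewrite bad_lang_cat mem_cat.
case/orP=> [/(nthP [::])[i hi <-]|/mapP[w hw ->]]; last exact: hix.
by rewrite nth_take //; apply: hfam.
Qed.

Lemma inL_bad s : admissible s -> inL bad_lang s -> bad s.
Proof.
case=> hn ht hl [e he hs]; split=> //; split=> //; split=> //.
move: hs; elim/in_bad_lang: e / he => [i|w hw]; last first.
  by case/lang_word=> s' -> ->; rewrite cats0; do 8!right.
(* These two symbols refute [no1] and [no0], and force [xs] to be nonempty in types II and III. *)
have [h0 h1] : 0 \in s /\ 1 \in s by split; apply/ht.
case: i => [|[|[|[|[|[|[|[|[|[|[|[|[|[|[|//]]]]]]]]]]]]]]] _.
- by move/lang_letters/allP/(_ _ h1).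
- by move/lang_letters/allP/(_ _ h0).
- case/lang_word=> s' -> /lang_power[k [s'' -> ->]]; left.
  by exists k.+2; rewrite cats0.
- case/lang_pairl=> xs; rewrite all_in01 => hxs [s' Es /= Es']; right; left.
  rewrite {}Es' cats0 in Es; exists xs; split; last by split=> //; left.
  by apply: contraTneq h0 => E; rewrite Es E.
- case/lang_word=> t Es /lang_pairl[xs]; rewrite all_in01 => hxs [s' Et /= Es'].
  rewrite {}Et {}Es' cats0 in Es; right; left.
  exists xs; split; last by split=> //; right.
  by apply: contraTneq h0 => E; rewrite Es E.
- case/lang_pairl=> xs; rewrite all_in12 => hxs [s' Es /lang_word[s'' Es' /= Es'']].
  rewrite {}Es' {}Es'' cats0 in Es; do 2!right; left.
  exists xs; split; last by split=> //; left.
  by apply: contraTneq h0 => E; rewrite Es E.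
- case/lang_word=> t Et /lang_pairl[xs].
  rewrite all_in12 => hxs [s' Es /lang_word[s'' Es' /= Es'']].
  rewrite {}Es {}Es' {}Es'' cats0 in Et; do 2!right; left.
  exists xs; split; last by split=> //; right.
  by apply: contraTneq h1 => E; rewrite Et E.
- case/lang_pairl=> p; rewrite all_in12 => hp [s1 -> /lang_word[s2 -> /lang_pairl[q]]].
  rewrite all_in12 => hq [s3 -> /lang_word[s4 -> ->]]; do 3!right; left; split.
    rewrite cats0 !count_cat; apply: leq_trans (leq_addl _ _).
    by rewrite /= !addn0 !add0n addn1 add1n.
  exists (p ++ 2 :: q); split; first by case: (p).
  by rewrite all_cat /= hp hq; split=> //; left; rewrite pairs_of_cat -catA.
- case/lang_pairr=> p; rewrite all_in12 => hp [s1 -> /lang_word[s2 -> /lang_pairr[q]]].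
  rewrite all_in12 => hq [s3 -> /lang_word[s4 -> ->]]; do 3!right; left; split.
    rewrite cats0 !count_cat; apply: leq_trans (leq_addl _ _).
    by rewrite /= !addn0 !add0n addn1 add1n.
  exists (p ++ 2 :: q); split; first by case: (p).
  by rewrite all_cat /= hp hq; split=> //; right; rewrite pairs_of_cat -catA.
- case/lang_power=> k [s' -> /lang_word[s'' -> ->]]; do 4!right; left; left.
  by exists k.
- case/lang_word=> s' -> /lang_power[k [s'' -> /lang_word[t -> ->]]].
  by do 4!right; left; right; exists k.+1.
- case/lang_word=> s1 -> /lang_power[k [s2 -> /lang_word[s3 ->]]].
  case/lang_power=> l [s4 -> /lang_word[s5 -> ->]].
  by do 5!right; left; left; exists k.+1, l.
- case/lang_word=> s1 -> /lang_power[k [s2 -> /lang_word[s3 ->]]].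
  case/lang_power=> l [s4 -> /lang_word[s5 -> ->]].
  by do 5!right; left; right; exists k.+1, l.
- case/lang_word=> s1 -> /lang_power[k [s2 -> /lang_word[s3 ->]]].
  case/lang_power=> l [s4 -> ->].
  by do 6!right; left; exists k.+1, l.+1; rewrite cats0.
- case/lang_word=> s1 -> /lang_power[k [s2 -> /lang_word[s3 -> ->]]].
  by do 7!right; left; exists k.+1.
Qed.

Lemma badP s : admissible s -> bad s <-> inL bad_lang s.
Proof. by move=> hs; split; [apply: bad_inL | apply: inL_bad]. Qed.

(** * Normalization and the effect of a flip *)

Lemma normalize_cons2 a b s :
  normalize [:: a, b & s] =
  if a == b then normalize (b :: s) else a :: normalize (b :: s).
Proof. by []. Qed.

Lemma normalize_id s : normalized s -> normalize s = s.
Proof.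
elim: s => [|a [|b s] IH] // /andP[ab hs].
by rewrite normalize_cons2 (negbTE ab) IH.
Qed.

Lemma normalize_dup u a v : normalize (u ++ [:: a, a & v]) = normalize (u ++ a :: v).
Proof.
elim: u => [|b u IH]; first by rewrite /= eqxx.
by case: u IH => [|c u] /= IH; rewrite IH.
Qed.

Lemma mem_normalize s : normalize s =i s.
Proof.
elim: s => [|a [|b s] IH] // x; rewrite normalize_cons2.
case: eqP => [->|_]; last by rewrite inE IH.
by rewrite IH !inE orbA orbb.
Qed.

Lemma last_normalize b s : last b (normalize s) = last b s.
Proof.
elim: s b => [|a [|c s] IH] // b; rewrite normalize_cons2.
by case: eqP => [->|_]; rewrite ?IH //= (IH a).
Qed.

Lemma normalize_rcons s a b : s != [::] ->
  normalize (rcons s b) =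
  if last a s == b then normalize s else rcons (normalize s) b.
Proof.
elim: s a => [|c [|d s] IH] a // _; first by rewrite /=; case: eqP => [->|].
rewrite !rcons_cons normalize_cons2 -rcons_cons (IH c isT) normalize_cons2 /=.
by do 2![case: ifP].
Qed.

Lemma normalized_rev s : normalized (rev s) = normalized s.
Proof. by rewrite /normalized rev_sorted; apply: eq_sorted => x y; rewrite eq_sym. Qed.

Lemma normalized_cat s a t :
  normalized (s ++ a :: t) = normalized (rcons s a) && normalized (a :: t).
Proof. by rewrite /normalized sorted_cat_cons. Qed.

Lemma normalized_shrink a x y :
  normalized (a :: x ++ a :: y) -> normalized (rev x ++ a :: y).
Proof.
rewrite -cat_cons !normalized_cat -rev_cons normalized_rev => /andP[+ ->].
by rewrite andbT -cats1 => /cat_sorted2[].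
Qed.

Lemma normalized_keep c x a y : c != a ->
  normalized (c :: x ++ a :: y) -> normalized (rev x ++ [:: c, a & y]).
Proof.
move=> ca; rewrite -cat_cons !normalized_cat -rev_cons normalized_rev.
have -> : normalized [:: c, a & y] = normalized (a :: y) by rewrite /normalized /= ca.
by move=> /andP[+ ->]; rewrite andbT -cats1 => /cat_sorted2[].
Qed.

Lemma flip_split c x y : flip (size x).+1 (c :: x ++ y) = normalize (rev x ++ c :: y).
Proof. by rewrite /flip /= take_size_cat // drop_size_cat // rev_cons cat_rcons. Qed.

Lemma flip_shrink a x y : normalized (a :: x ++ a :: y) ->
  flip (size x).+1 (a :: x ++ a :: y) = rev x ++ a :: y.
Proof.
by move=> h; rewrite flip_split normalize_dup normalize_id ?(normalized_shrink h).
Qed.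

Lemma flip_keep c x a y : c != a -> normalized (c :: x ++ a :: y) ->
  flip (size x).+1 (c :: x ++ a :: y) = rev x ++ [:: c, a & y].
Proof.
by move=> ca h; rewrite flip_split normalize_id ?(normalized_keep ca h).
Qed.

(** Flipping a proper prefix creates a single new adjacency, between the first symbol [c] and the
    symbol [a] after the prefix, so a merge occurs only if [c = a]. Reversing the whole string
    creates none. *)
Lemma flip_cases i s : 0 < i <= size s -> normalized s ->
  [\/ exists a x y, s = a :: x ++ a :: y /\ flip i s = rev x ++ a :: y,
      exists c x a y, [/\ c != a, s = c :: x ++ a :: y &
                          flip i s = rev x ++ [:: c, a & y]]
    | flip i s = rev s].
Proof.
case/andP=> i0; rewrite leq_eqVlt => /orP[/eqP ->|hi] hn.
  apply: Or33; rewrite /flip take_size drop_size cats0 normalize_id //.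
  by rewrite normalized_rev.
case: s i0 hi hn => [//|c s]; case: i => // i _; rewrite /= ltnS => hi.
case E: (drop i s) => [|a y] hn.
  by move/(congr1 size): E; rewrite size_drop => /eqP; rewrite subn_eq0 leqNgt hi.
have Ei : size (take i s) = i by rewrite size_takel // ltnW.
have Es := cat_take_drop i s; rewrite {}E in Es.
move: (take i s) Es Ei => x Es Ei; rewrite -{}Es -{}Ei in hn *.
have [E|ca] := eqVneq c a.
  by subst c; apply: Or31; exists a, x, y; rewrite flip_shrink.
by apply: Or32; exists c, x, a, y; rewrite flip_keep.
Qed.

Lemma admissible_mem s t :
  normalized t -> t =i s -> last 0 t = last 0 s -> admissible s -> admissible t.
Proof.
move=> hn hm hl [_ ht hl2]; split=> [//|x|]; last by rewrite hl.
by rewrite hm; apply: ht.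
Qed.

Lemma admissible_shrink a x y :
  admissible (a :: x ++ a :: y) -> admissible (rev x ++ a :: y).
Proof.
move=> h; have [hn _ _] := h; apply: admissible_mem h; first exact: normalized_shrink hn.
  by move=> z; rewrite !(mem_cat, inE, mem_rev); case: (z == a); rewrite ?orbT.
by rewrite /= !last_cat.
Qed.

Lemma admissible_keep c x a y : c != a ->
  admissible (c :: x ++ a :: y) -> admissible (rev x ++ [:: c, a & y]).
Proof.
move=> ca h; have [hn _ _] := h; apply: admissible_mem h.
- exact: normalized_keep hn.
- by move=> z; rewrite !(mem_cat, inE, mem_rev) orbCA.
- by rewrite /= !last_cat.
Qed.

(** * Lower bounds from lengths *)

Lemma size_shrink (a : nat) x y : size (a :: x ++ a :: y) = (size (rev x ++ a :: y)).+1.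
Proof. by rewrite /= !size_cat size_rev. Qed.

Lemma size_keep (c a : nat) x y : size (rev x ++ [:: c, a & y]) = size (c :: x ++ a :: y).
Proof. by rewrite /= !size_cat size_rev /= !addnS. Qed.

Lemma size_admissible s : admissible s -> 2 < size s.
Proof.
case=> _ ht _; apply: (@uniq_leq_size _ [:: 0; 1; 2]) => // x.
by rewrite !inE => /or3P[] /eqP ->; apply/ht.
Qed.

Lemma reach_size d s : normalized s -> reach d s target -> size s <= d.+3.
Proof.
elim: d s => [|d IH] s hn /=; first by move->.
case=> i [hi hr]; suff [hn' hs] : normalized (flip i s) /\ size s <= (size (flip i s)).+1.
  by apply: leq_trans hs _; rewrite ltnS; apply: IH.
case: (flip_cases hi hn) => [[a [x [y [Es ->]]]]|[c [x [a [y [ca Es ->]]]]]|->].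
- by rewrite Es in hn *; rewrite size_shrink (normalized_shrink hn).
- by rewrite Es in hn *; rewrite size_keep (normalized_keep ca hn).
- by rewrite normalized_rev size_rev.
Qed.

Lemma target_good : ~ inL bad_lang target.
Proof.
move=> h; have : accept (deriv 2 (deriv 1 (deriv 0 bad_lang))).
  by apply/inL_nil/inL_deriv/inL_deriv/inL_deriv.
by vm_compute.
Qed.

(** The budget is tight, so every flip has to shrink; a bad string would then stay bad all the way
    to the target, which is good. *)
Lemma reach_good d s :
  admissible s -> size s = d.+3 -> reach d s target -> ~ inL bad_lang s.
Proof.
elim: d s => [|d IH] s hs hsz; first by move=> /= ->; exact: target_good.
case=> i [hi hr] hbad; have [hn _ _] := hs; move: hr.
case: (flip_cases hi hn) => [[a [x [y [Es ->]]]]|[c [x [a [y [ca Es ->]]]]]|->].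
- rewrite Es in hs hsz hbad; move/IH; apply; first exact: admissible_shrink hs.
    by move: hsz; rewrite size_shrink => -[].
  exact: bad_shrinks hbad.
- rewrite Es in hn hsz; move/(reach_size (normalized_keep ca hn)).
  by rewrite size_keep hsz ltnn.
- move/reach_size; rewrite normalized_rev size_rev hsz ltnn => h.
  by have := h hn.
Qed.

(** * Upper bounds by flips that fix the last symbol *)

(** Only proper prefixes are flipped. Such flips of [rcons s 2] are also flips of [s], which later
    carries the upper bound over to strings not ending in [2]. *)
Fixpoint inner_reach (k : nat) (s t : seq nat) : Prop :=
  if k is k'.+1 then exists2 i, 0 < i < size s & inner_reach k' (flip i s) t
  else s = t.

Lemma inner_reach_reach k s t : inner_reach k s t -> reach k s t.
Proof.
elim: k s => [|k IH] s //= [i /andP[i0 hi] /IH h].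
by exists i; rewrite i0 ltnW.
Qed.

Lemma inner_index c x (a : nat) y : 0 < (size x).+1 < size (c :: x ++ a :: y).
Proof. by rewrite /= size_cat /= addnS ltnS leq_addr. Qed.

Lemma inner_reach_shrink d a x y : normalized (a :: x ++ a :: y) ->
  inner_reach d (rev x ++ a :: y) target -> inner_reach d.+1 (a :: x ++ a :: y) target.
Proof.
by move=> hn h; exists (size x).+1; [apply: inner_index | rewrite flip_shrink].
Qed.

Lemma good_inner_reach d s :
  admissible s -> size s = d.+3 -> ~ inL bad_lang s -> inner_reach d s target.
Proof.
elim: d s => [|d IH] s hs hsz hg.
  have [//|neq] := eqVneq s target.
  (* A string of length three other than the target would shrink to a fully ternary string of length
     two. *)
  have [a [x [y [Es _]]]] := good_shrinks hs hg (elimN eqP neq).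
  rewrite Es in hs hsz; have := size_admissible (admissible_shrink hs).
  by move: hsz; rewrite size_shrink => -[->].
have neq : s <> target by move=> E; rewrite E in hsz.
have [a [x [y [Es hg']]]] := good_shrinks hs hg neq.
rewrite Es in hs hsz *; have [hn _ _] := hs.
apply: inner_reach_shrink => //; apply: IH => //; first exact: admissible_shrink hs.
by move: hsz; rewrite size_shrink => -[].
Qed.

(* [0212] is the only bad string that needs one flip more than the others, so a
   shrinking flip to it must be replaced. *)
Lemma shrink_to_0212 a x y :
  rev x ++ a :: y = [:: 0; 2; 1; 2] -> normalized (a :: x ++ a :: y) ->
  inner_reach 3 (a :: x ++ a :: y) target.
Proof.
(* By the length of [x], the string is [00212], which is not normalized, or [20212], [12012] or
   [21202], each with an explicit sorting by three flips. *)
have := revK x; move: (rev x) => z <- {x}; case: z => [|x0 [|x1 [|x2 [|x3 z]]]] /=.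
- by case=> -> ->.
- by case=> -> -> -> _; exists 4 => //; exists 2 => //; exists 3.
- by case=> -> -> -> -> _; exists 2 => //; exists 4 => //; exists 2.
- by case=> -> -> -> -> -> _; exists 2 => //; exists 2 => //; exists 3.
- by case=> _ _ _ _; case: z.
Qed.

(** The budget exceeds that of a good string by one flip. A shrinking flip leads to a bad string and
    keeps this surplus; a length-preserving flip to a good string spends it. *)
Lemma bad_inner_reach d s :
  admissible s -> s <> [:: 0; 2; 1; 2] -> size s = d.+2 -> inL bad_lang s ->
  inner_reach d s target.
Proof.
elim: d s => [|d IH] s hs hneq hsz hb; first by move: (size_admissible hs); rewrite hsz.
have [hn _ _] := hs.
have [[a [x [y Es]]]|[c [x [a [y [Es ca hg]]]]]] := bad_exit hs hb hneq.
  rewrite Es in hs hsz hb hn *.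
  have Esz : size (rev x ++ a :: y) = d.+2 by move: hsz; rewrite size_shrink => -[].
  have [E|neq] := eqVneq (rev x ++ a :: y) [:: 0; 2; 1; 2].
    have Ed : d = 2 by move: Esz; rewrite E => -[].
    by rewrite Ed; apply: shrink_to_0212.
  apply: inner_reach_shrink => //; apply: IH => //; first exact: admissible_shrink hs.
    exact/eqP.
  exact: bad_shrinks hb.
rewrite Es in hs hsz hn *; exists (size x).+1; first exact: inner_index.
rewrite flip_keep //; apply: good_inner_reach => //; first exact: admissible_keep.
by rewrite size_keep.
Qed.

(** * Sorting distances of strings ending in 2 *)

Lemma reach_0212 m : reach m [:: 0; 2; 1; 2] target -> 2 < m.
Proof.
case: m => [//|[|[|//]]] /= [i [hi]].
  by case: i hi => [|[|[|[|[|i]]]]].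
case=> j []; case: i hi => [|[|[|[|[|i]]]]] // _;
  by case: j => [|[|[|[|[|j]]]]].
Qed.

(** Deliberately asymmetric: the distance is attained by inner flips, but is minimal among all
    flips. *)
Definition inner_distance_is (s : seq nat) (d : nat) : Prop :=
  inner_reach d s target /\ (forall m, m < d -> ~ reach m s target).

Lemma inner_distance_sorting s d : inner_distance_is s d -> sorting_distance_is s d.
Proof. by case=> /inner_reach_reach. Qed.

Lemma inner_distance_0212 : inner_distance_is [:: 0; 2; 1; 2] 3.
Proof.
split; first by exists 2 => //; exists 3 => //; exists 2.
by move=> m hm /reach_0212; rewrite ltnNge -ltnS hm.
Qed.

Lemma inner_distance_bad s : admissible s -> s <> [:: 0; 2; 1; 2] ->
  inL bad_lang s -> inner_distance_is s (size s - 2).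
Proof.
move=> hs hneq hb; have h3 := size_admissible hs; split.
  by apply: bad_inner_reach => //; rewrite -addn2 subnK // ltnW.
move=> m; rewrite ltn_subRL add2n => hm hr; have [hn _ _] := hs.
(* Here [m.+3 <= size s], and [reach_size] gives the converse inequality, so the budget is tight. *)
apply: (reach_good hs _ hr hb); apply/eqP.
by rewrite eqn_leq (reach_size hn hr).
Qed.

Lemma inner_distance_good s : admissible s -> ~ inL bad_lang s ->
  inner_distance_is s (size s - 3).
Proof.
move=> hs hg; have h3 := size_admissible hs; split.
  by apply: good_inner_reach => //; rewrite -addn3 subnK.
move=> m; rewrite ltn_subRL add3n => hm hr; have [hn _ _] := hs.
by have := reach_size hn hr; rewrite leqNgt hm.
Qed.

Lemma inner_distance_exists s : admissible s -> exists d, inner_distance_is s d.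
Proof.
move=> hs; have [->|/eqP neq] := eqVneq s [:: 0; 2; 1; 2].
  by exists 3; apply: inner_distance_0212.
have [s0 [_ _ hacc]] := admissible_state hs.
case: (boolP (accept (state_of s0).1.2)) => [/hacc hb|/negP hg].
  by exists (size s - 2); apply: inner_distance_bad.
by exists (size s - 3); apply: inner_distance_good => // /hacc.
Qed.

(** * Strings ending in 0 or 1 *)

Lemma sorting_distance_uniq s d e :
  sorting_distance_is s d -> sorting_distance_is s e -> d = e.
Proof.
case=> hd hd' [he he']; case: (ltngtP d e) => // h; first by case: (he' _ h).
by case: (hd' _ h).
Qed.

Lemma flip_neq0 i (s : seq nat) : 0 < i <= size s -> rev (take i s) ++ drop i s != [::].
Proof.
case/andP=> i0 hi; rewrite -size_eq0 size_cat size_rev -size_cat cat_take_drop.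
by rewrite -lt0n (leq_trans i0).
Qed.

(** The flip does not move the appended [b], which can only merge with the last symbol of the
    flipped string. That string is nonempty, so the default [b.+1] is never returned. *)
Lemma flip_rcons i s b : 0 < i <= size s ->
  flip i (rcons s b) =
  if last b.+1 (flip i s) == b then flip i s else rcons (flip i s) b.
Proof.
move=> hi; have /andP[i0 his] := hi; rewrite /flip last_normalize.
rewrite -(normalize_rcons b.+1 b (flip_neq0 hi)) -!cats1 take_cat drop_cat.
case: ltngtP his => // [_ _|-> _]; first by rewrite catA.
by rewrite subnn /= take_size drop_size !cats0.
Qed.

Lemma fully_ternary_flip i s : fully_ternary s -> fully_ternary (flip i s).
Proof.
move=> ht x; rewrite mem_normalize mem_cat mem_rev -mem_cat cat_take_drop.
exact: ht.
Qed.

(* Both directions follow the same flips on [s] and on [s2]; the two strings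
   coincide as soon as the first one acquires a final [2]. *)
Lemma reach_rcons d s : fully_ternary s -> last 0 s != 2 ->
  reach d s target -> reach d (rcons s 2) target.
Proof.
elim: d s => [|d IH] s ht hl /=; first by move=> E; rewrite E in hl.
case=> i [hi hr]; exists i; split.
  by case/andP: hi => -> h; rewrite size_rcons ltnW.
have ne : flip i s != [::].
  by apply: contraTneq isT => E; have := fully_ternary_flip i ht 0; rewrite E => -[_ /(_ isT)].
rewrite flip_rcons //; case: eqP => // /eqP hl'; apply: IH => //.
  exact: fully_ternary_flip.
by case: (flip i s) ne hl'.
Qed.

Lemma inner_reach_rcons d s : fully_ternary s -> last 0 s != 2 ->
  inner_reach d (rcons s 2) target -> reach d s target.
Proof.
elim: d s => [|d IH] s ht hl /=.
  (* Without flips [s] would be [01], which is not fully ternary. *)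
  case: s ht hl => [|a [|b [|c s]]] //= ht _ [E1 E2]; last by case: s {ht} E2 => [|? ?] //= [].
  by have := ht 2; rewrite E1 E2 !inE => -[_ /(_ isT)].
case=> i hi; rewrite size_rcons ltnS in hi; rewrite flip_rcons // => hr.
exists i; split=> //; move: hr; case: eqP => [_ /inner_reach_reach|/eqP hl'] //.
apply: IH; first exact: fully_ternary_flip.
have := fully_ternary_flip i ht 0.
by case: (flip i s) hl' => [_ [_ /(_ isT)]|].
Qed.

Theorem theorem4p4 :
  sorting_distance_is [:: 0; 2; 1; 2] 3 /\
  (forall s : seq nat,
      normalized s -> fully_ternary s -> last 0 s = 2 -> s <> [:: 0; 2; 1; 2] ->
      (bad s -> sorting_distance_is s (size s - 2)) /\
      (~ bad s -> sorting_distance_is s (size s - 3))) /\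
  (forall s : seq nat,
      normalized s -> fully_ternary s -> (last 0 s = 0 \/ last 0 s = 1) ->
      forall d : nat, sorting_distance_is s d <-> sorting_distance_is (rcons s 2) d).
Proof.
split; first exact: inner_distance_sorting inner_distance_0212.
split=> [s hn ht hl hneq|s hn ht hl d].
  have hs : admissible s by [].
  split=> [/(badP hs) hb|hg]; apply: inner_distance_sorting.
    exact: inner_distance_bad.
  by apply: inner_distance_good => // /(badP hs).
have hl2 : last 0 s != 2 by case: hl => ->.
have hs2 : admissible (rcons s 2).
  split; last by rewrite last_rcons.
    case: s hn hl2 {ht hl} => [//|a s] hn /= hl2.
    by rewrite /normalized /= rcons_path; apply/andP.
  move=> x; rewrite mem_rcons inE; split=> [/orP[/eqP -> //|/ht //]|/ht ->]; exact: orbT.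
(* A distance [e] of [rcons s 2], attained by inner flips, is also the distance of [s]; uniqueness
   then gives the equivalence for every [d]. *)
have [e he] := inner_distance_exists hs2.
have he2 := inner_distance_sorting he.
have he1 : sorting_distance_is s e.
  case: he => hr hmin; split; first exact: inner_reach_rcons hr.
  by move=> m /hmin h /(reach_rcons ht hl2).
by split=> h; [rewrite (sorting_distance_uniq h he1) | rewrite (sorting_distance_uniq h he2)].
Qed.
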